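(* Let $n\ge 1$ and let $\mu$ be a non-trivial probability measure on $\partial\mathbb{D}$. Then the compressed multiplication operator $A^\mu=P_nM_zP_n\restriction\mathcal{P}_{n-1}$, acting on the $n$-dimensional Hilbert space $\mathcal{P}_{n-1}\subset L^2(\partial\mathbb{D},d\mu)$, lies in $S_n$.
   Context: $\mathbb{D}=\{z\in\mathbb{C}:|z|<1\}$. A probability measure $\mu$ on $\partial\mathbb{D}$ is non-trivial if it is not supported on a finite set. $\mathcal{P}_{n-1}$ is the space of complex polynomials of degree at most $n-1$, viewed as an $n$-dimensional subspace of $L^2(\partial\mathbb{D},d\mu)$ with the inherited inner product; $P_n$ is the orthogonal projection of $L^2(\partial\mathbb{D},d\mu)$ onto $\mathcal{P}_{n-1}$; $M_z$ is multiplication by $z$ on $L^2(\partial\mathbb{D},d\mu)$. The compressed multiplication operator of $\mu$ (of dimension $n$) is $A^\mu=P_nM_zP_n\restriction\mathcal{P}_{n-1}$. $S_n$ is the set of operators $A$ on an $n$-dimensional complex Hilbert space such that: $A$ is a contraction ($\|A\|\le 1$); $A$ is completely non-unitary, which in finite dimension means $A$ has no eigenvalue of absolute value $1$; and $A$ has defect index $1$, i.e. $\dim\operatorname{ran}(\mathbf{1}-A^*A)=1$. *)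

(* Defs.v *)
From HB Require Import structures.
From mathcomp Require Import all_boot all_order all_algebra.
From mathcomp Require Import all_classical all_reals all_analysis.
From mathcomp Require Import measurable_realfun complex.
Set Implicit Arguments.
Unset Strict Implicit.
Unset Printing Implicit Defensive.
Import Order.TTheory GRing.Theory Num.Theory.
Import numFieldNormedType.Exports.
Local Open Scope classical_set_scope.
Local Open Scope ring_scope.

Local Notation Re := (@complex.Re _).
Local Notation Im := (@complex.Im _).

Section ComplexParts.
Variable R : realType.
Implicit Types x y : R[i].

Lemma normc_sqr x : Normc.normc x ^+ 2 = Re x ^+ 2 + Im x ^+ 2.
Proof. by case: x => a b /=; rewrite sqr_sqrtr// addr_ge0 ?sqr_ge0. Qed.

Lemma ReD x y : Re (x + y) = Re x + Re y.
Proof. by case: x y => [? ?] [? ?]. Qed.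

Lemma ImD x y : Im (x + y) = Im x + Im y.
Proof. by case: x y => [? ?] [? ?]. Qed.

Lemma ReM x y : Re (x * y) = Re x * Re y - Im x * Im y.
Proof. by case: x y => [? ?] [? ?]. Qed.

Lemma ImM x y : Im (x * y) = Re x * Im y + Im x * Re y.
Proof. by case: x y => [? ?] [? ?]. Qed.

Lemma ReJ x : Re x^* = Re x.
Proof. by case: x. Qed.

Lemma ImJ x : Im x^* = - Im x.
Proof. by case: x. Qed.

Lemma complex_ext x y : Re x = Re y -> Im x = Im y -> x = y.
Proof. by case: x y => [? ?] [? ?] /= -> ->. Qed.

End ComplexParts.

Section SquareIntegrable.
Context d (T : measurableType d) (R : realType).
Variable mu : {measure set T -> \bar R}.
Local Notation C := R[i].
Implicit Types f g : T -> C.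

Definition cmeasurable f :=
  measurable_fun setT (Re \o f) /\ measurable_fun setT (Im \o f).

(* Normc.normc is the R-valued modulus; `|z| is an element of R[i]. *)
Definition square_integrable f :=
  cmeasurable f /\ (\int[mu]_x (Normc.normc (f x) ^+ 2)%:E < +oo)%E.

Definition cintegral f : C :=
  Complex (\int[mu]_x Re (f x)) (\int[mu]_x Im (f x)).

Definition cintegrable f :=
  mu.-integrable setT (EFin \o (Re \o f)) /\
  mu.-integrable setT (EFin \o (Im \o f)).

Lemma cmeasurable_cst c : cmeasurable (fun=> c).
Proof. by split; exact: measurable_cst. Qed.

Lemma cmeasurableD f g :
  cmeasurable f -> cmeasurable g -> cmeasurable (fun x => f x + g x).
Proof.
move=> [rf jf] [rg jg]; split.
- have -> : Re \o (fun x => f x + g x) = (Re \o f) \+ (Re \o g).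
    by apply/funext => x /=; rewrite ReD.
  exact: measurable_funD.
- have -> : Im \o (fun x => f x + g x) = (Im \o f) \+ (Im \o g).
    by apply/funext => x /=; rewrite ImD.
  exact: measurable_funD.
Qed.

Lemma cmeasurableM f g :
  cmeasurable f -> cmeasurable g -> cmeasurable (fun x => f x * g x).
Proof.
move=> [rf jf] [rg jg]; split.
- have -> : Re \o (fun x => f x * g x) =
      ((Re \o f) \* (Re \o g)) \- ((Im \o f) \* (Im \o g)).
    by apply/funext => x /=; rewrite ReM.
  by apply: measurable_funB; exact: measurable_funM.
- have -> : Im \o (fun x => f x * g x) =
      ((Re \o f) \* (Im \o g)) \+ ((Im \o f) \* (Re \o g)).
    by apply/funext => x /=; rewrite ImM.
  by apply: measurable_funD; exact: measurable_funM.
Qed.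

Lemma cmeasurableJ f : cmeasurable f -> cmeasurable (fun x => (f x)^*).
Proof.
move=> [rf jf]; split.
  have -> : Re \o (fun x => (f x)^*) = Re \o f.
    by apply/funext => x /=; rewrite ReJ.
  exact: rf.
have -> : Im \o (fun x => (f x)^*) = \- (Im \o f).
  by apply/funext => x /=; rewrite ImJ.
exact: measurableT_comp.
Qed.

Lemma Lfun2P (h : T -> R) : h \in Lfun mu 2%:E <->
  measurable_fun setT h /\ (\int[mu]_x (h x ^+ 2)%:E < +oo)%E.
Proof.
split.
  move=> h2; split.
    by move: h2; rewrite inE => /andP[]; rewrite inE.
  have /integrableP[_] := Lfun2_integrable_sqr h2.
  by under eq_integral do rewrite /= ger0_norm ?sqr_ge0//.
move=> [mh h2]; rewrite inE; apply/andP; split; rewrite inE//=.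
rewrite /finite_norm unlock /Lnorm poweR_lty//.
by under eq_integral do rewrite /= -[2]/(2%:R) powR_mulrn// real_normK ?num_real//.
Qed.

Lemma square_integrableP f : square_integrable f <->
  Re \o f \in Lfun mu 2%:E /\ Im \o f \in Lfun mu 2%:E.
Proof.
split=> [[[rf jf] f2]|[/Lfun2P[rf rf2] /Lfun2P[jf jf2]]].
  split; apply/Lfun2P; split => //; apply: le_lt_trans f2.
    apply: ge0_le_integral => //.
    - by move=> x _; rewrite lee_fin sqr_ge0.
    - by apply/measurable_EFinP; exact: measurable_funX.
    - apply/measurable_EFinP; under eq_fun do rewrite normc_sqr.
      by apply: measurable_funD; exact: measurable_funX.
    - by move=> x _; rewrite lee_fin normc_sqr lerDl sqr_ge0.
  apply: ge0_le_integral => //.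
  - by move=> x _; rewrite lee_fin sqr_ge0.
  - by apply/measurable_EFinP; exact: measurable_funX.
  - apply/measurable_EFinP; under eq_fun do rewrite normc_sqr.
    by apply: measurable_funD; exact: measurable_funX.
  - by move=> x _; rewrite lee_fin normc_sqr lerDr sqr_ge0.
split => //; under eq_integral do rewrite normc_sqr EFinD.
rewrite ge0_integralD//=.
- by rewrite lte_add_pinfty.
- by move=> x _; rewrite lee_fin sqr_ge0.
- by apply/measurable_EFinP; exact: measurable_funX.
- by move=> x _; rewrite lee_fin sqr_ge0.
- by apply/measurable_EFinP; exact: measurable_funX.
Qed.

Lemma square_integrable0 : square_integrable (0 : T -> C).
Proof.
apply/square_integrableP; have e : (1 <= 2%:E :> \bar R)%E by rewrite lee1n.
by split; exact: (Lfun_submod_closed mu e).1.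
Qed.

Lemma square_integrableD f g : square_integrable f -> square_integrable g ->
  square_integrable (f + g).
Proof.
move=> /square_integrableP[rf jf] /square_integrableP[rg jg].
have e : (1 <= 2%:E :> \bar R)%E by rewrite lee1n.
apply/square_integrableP; split.
- have -> : Re \o (f + g) = (Re \o f) + (Re \o g).
    by apply/funext => x /=; rewrite !fctE ReD.
  exact: (Lfun_addr_closed mu e).2.
- have -> : Im \o (f + g) = (Im \o f) + (Im \o g).
    by apply/funext => x /=; rewrite !fctE ImD.
  exact: (Lfun_addr_closed mu e).2.
Qed.

Lemma square_integrable_bounded (b : T -> C) (M : R) f :
  cmeasurable b -> (forall x, Normc.normc (b x) <= M) ->
  square_integrable f -> square_integrable (fun x => b x * f x).
Proof.
move=> mb bM [mf f2]; split; first exact: cmeasurableM.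
have mN h : cmeasurable h ->
    measurable_fun setT (fun x => (Normc.normc (h x) ^+ 2)%:E).
  move=> [rh jh]; apply/measurable_EFinP; under eq_fun do rewrite normc_sqr.
  by apply: measurable_funD; exact: measurable_funX.
apply: (@le_lt_trans _ _ (\int[mu]_x ((M ^+ 2)%:E * (Normc.normc (f x) ^+ 2)%:E))%E).
  apply: ge0_le_integral => //.
  - by move=> x _; rewrite lee_fin sqr_ge0.
  - by apply: mN; exact: cmeasurableM.
  - by apply: measurable_funeM; exact: mN.
  - move=> x _; rewrite Normc.normcM exprMn -EFinM lee_fin ler_wpM2r ?sqr_ge0//.
    rewrite lerXn2r// nnegrE.
      by case: (b x) => u v /=; rewrite sqrtr_ge0.
    apply: le_trans (bM x).
    by case: (b x) => u v /=; rewrite sqrtr_ge0.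
rewrite ge0_integralZl//.
- by rewrite lte_mul_pinfty// lee_fin sqr_ge0.
- exact: mN.
- by move=> x _; rewrite lee_fin sqr_ge0.
- by rewrite lee_fin sqr_ge0.
Qed.

Lemma square_integrableZ a f : square_integrable f -> square_integrable (a *: f).
Proof.
by apply: (@square_integrable_bounded (fun=> a) (Normc.normc a)) => // ;
  exact: cmeasurable_cst.
Qed.

Lemma cintegrableMJ f g : square_integrable f -> square_integrable g ->
  cintegrable (fun x => f x * (g x)^*).
Proof.
move=> /square_integrableP[rf jf] /square_integrableP[rg jg].
have I h k : h \in Lfun mu 2%:E -> k \in Lfun mu 2%:E ->
    mu.-integrable setT (EFin \o (h \* k)).
  by move=> h2 k2; exact/Lfun1_integrable/Lfun2_mul_Lfun1.
split.
- have -> : EFin \o (Re \o (fun x => f x * (g x)^*)) =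
    ((EFin \o ((Re \o f) \* (Re \o g))%R) \+ (EFin \o ((Im \o f) \* (Im \o g))%R))%E.
    by apply/funext => x /=; rewrite -EFinD ReM ReJ ImJ mulrN opprK.
  by apply: integrableD => //; exact: I.
- have -> : EFin \o (Im \o (fun x => f x * (g x)^*)) =
    ((EFin \o ((Im \o f) \* (Re \o g))%R) \- (EFin \o ((Re \o f) \* (Im \o g))%R))%E.
    by apply/funext => x /=; rewrite -EFinB ImM ReJ ImJ mulrN addrC.
  by apply: integrableB => //; exact: I.
Qed.

Lemma cintegralD f g : cintegrable f -> cintegrable g ->
  cintegral (fun x => f x + g x) = cintegral f + cintegral g.
Proof.
move=> [rf jf] [rg jg]; apply: complex_ext; rewrite ?ReD ?ImD /=.
  by under eq_Rintegral do rewrite ReD; rewrite RintegralD.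
by under eq_Rintegral do rewrite ImD; rewrite RintegralD.
Qed.

Lemma cintegralZ a f : cintegrable f ->
  cintegral (fun x => a * f x) = a * cintegral f.
Proof.
move=> [rf jf].
have I r h : mu.-integrable setT (EFin \o h) ->
    mu.-integrable setT (EFin \o (fun x => r * h x)).
  move=> ih; rewrite (_ : _ \o _ = (fun x => r%:E * (EFin \o h) x)%E)//.
  exact: integrableZl.
apply: complex_ext; rewrite ?ReM ?ImM /=.
  under eq_Rintegral do rewrite ReM.
  by rewrite RintegralB// ?(I _ (Re \o f)) ?(I _ (Im \o f))// !RintegralZl.
under eq_Rintegral do rewrite ImM.
by rewrite RintegralD// ?(I _ (Re \o f)) ?(I _ (Im \o f))// !RintegralZl.
Qed.

Lemma cintegralJ f : cintegrable f ->
  cintegral (fun x => (f x)^*) = (cintegral f)^*.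
Proof.
move=> [rf jf]; apply: complex_ext; rewrite ?ReJ ?ImJ /=.
  by under eq_Rintegral do rewrite ReJ.
under eq_Rintegral do rewrite ImJ -mulN1r.
by rewrite RintegralZl// mulN1r.
Qed.

Lemma ae_eq_cintegral f g : cmeasurable f -> cmeasurable g ->
  (\forall x \ae mu, f x = g x) -> cintegral f = cintegral g.
Proof.
move=> [rf jf] [rg jg] fg; apply: complex_ext => /=; congr fine.
  apply: ae_eq_integral => //; [exact/measurable_EFinP..|].
  by apply: filterS fg => x /= ->.
apply: ae_eq_integral => //; [exact/measurable_EFinP..|].
by apply: filterS fg => x /= ->.
Qed.

Lemma cintegral_sqr_eq0 f : square_integrable f ->
  cintegral (fun x => f x * (f x)^*) = 0 -> \forall x \ae mu, f x = 0.
Proof.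
move=> sf /(congr1 (@complex.Re R)) /=.
have [if2 _] := cintegrableMJ sf sf.
rewrite /Rintegral => if0.
have E x : Re (f x * (f x)^*) = Normc.normc (f x) ^+ 2.
  by rewrite ReM ReJ ImJ mulrN opprK normc_sqr !expr2.
have : (\int[mu]_x `|(Re (f x * (f x)^*))%:E| = 0)%E.
  rewrite -[RHS](_ : (fine (\int[mu]_x (Re (f x * (f x)^*))%:E))%:E = 0)%E.
    rewrite fineK ?integrable_fin_num//.
    by apply: eq_integral => x _; rewrite gee0_abs// lee_fin E sqr_ge0.
  by rewrite if0.
move/ae_eq_integral_abs => /(_ measurableT (measurable_int _ if2)).
apply: filterS => x /= /(_ I) []; rewrite E => /eqP.
by rewrite sqrf_eq0 => /eqP /Normc.eq0_normc.
Qed.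

Lemma cintegral_sqr_ge0 f : square_integrable f ->
  0 <= cintegral (fun x => f x * (f x)^*).
Proof.
move=> sf; rewrite lecE /=; apply/andP; split.
  under eq_Rintegral do rewrite ImM ReJ ImJ mulrN mulrC addNr.
  by rewrite /Rintegral integral0.
apply: Rintegral_ge0 => x _.
by rewrite ReM ReJ ImJ mulrN opprK -!expr2 addr_ge0 ?sqr_ge0.
Qed.

End SquareIntegrable.

Section L2Space.
Context d (T : measurableType d) (R : realType).
Variable mu : {measure set T -> \bar R}.
Local Notation C := R[i].

Definition L2fun_pred : {pred T -> C} := fun f => `[< square_integrable mu f >].

Fact L2fun_submod_closed : submod_closed L2fun_pred.
Proof.
split; first exact/asboolP/square_integrable0.
move=> a f g /asboolP sf /asboolP sg; apply/asboolP.
by apply: square_integrableD => //; exact: square_integrableZ.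
Qed.

HB.instance Definition _ :=
  GRing.isSubmodClosed.Build C (T -> C) L2fun_pred L2fun_submod_closed.

Record L2fun : Type := MkL2fun {
  L2fun_val :> T -> C;
  _ : L2fun_val \in L2fun_pred
}.

HB.instance Definition _ := [isSub for L2fun_val].
HB.instance Definition _ := [Choice of L2fun by <:].
HB.instance Definition _ := [SubChoice_isSubLmodule of L2fun by <:].

Lemma L2funP (f : L2fun) : square_integrable mu f.
Proof. by case: f => f /= /asboolP. Qed.

Definition null_fun : {pred L2fun} :=
  fun f => `[< \forall x \ae mu, f x = 0 >].

Fact null_fun_zmod_closed : zmod_closed null_fun.
Proof.
split; first by apply/asboolP/aeW.
move=> f g /asboolP f0 /asboolP g0; apply/asboolP.
by apply: filterS2 f0 g0 => x fx gx; rewrite /= !fctE fx gx subr0.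
Qed.

HB.instance Definition _ :=
  GRing.isZmodClosed.Build L2fun null_fun null_fun_zmod_closed.

(* The complex space L^2(mu): square-integrable functions modulo equality
   mu-almost everywhere (see L2_eqP). *)
Definition L2 : Type := Quotient.quot null_fun.
HB.instance Definition _ := GRing.Zmodule.on L2.
HB.instance Definition _ := EqQuotient.on L2.

Local Open Scope quotient_scope.

Lemma L2_eqP (f g : L2fun) :
  f = g %[mod L2] <-> \forall x \ae mu, f x = g x.
Proof.
split.
  move/eqP; rewrite -Quotient.idealrBE => /asboolP.
  by apply: filterS => x; rewrite /= !fctE => /subr0_eq.
move=> fg; apply/eqP; rewrite -Quotient.idealrBE; apply/asboolP.
by apply: filterS fg => x; rewrite /= !fctE => ->; rewrite subrr.
Qed.

Lemma L2W (P : L2 -> Prop) : (forall f, P (\pi_L2 f)) -> forall u, P u.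
Proof. by move=> h u; rewrite -[u]reprK. Qed.

Lemma L2_repr (f : L2fun) : \forall x \ae mu, repr (\pi_L2 f) x = f x.
Proof. by apply/L2_eqP; rewrite reprK. Qed.

Definition L2scale (a : C) (u : L2) : L2 := \pi_L2 (a *: repr u).

Lemma L2pi_scale a f : L2scale a (\pi_L2 f) = \pi_L2 (a *: f).
Proof.
apply/L2_eqP; apply: filterS (L2_repr f) => x e.
by rewrite /= !fctE e.
Qed.

Lemma L2piD f g : \pi_L2 (f + g) = \pi_L2 f + \pi_L2 g.
Proof. by rewrite !piE. Qed.

Lemma L2piB f g : \pi_L2 (f - g) = \pi_L2 f - \pi_L2 g.
Proof. by rewrite !piE. Qed.

Fact L2scaleA a b u : L2scale a (L2scale b u) = L2scale (a * b) u.
Proof. by elim/L2W: u => f; rewrite 3!L2pi_scale scalerA. Qed.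

Fact L2scale1 : left_id 1 L2scale.
Proof. by elim/L2W => f; rewrite L2pi_scale scale1r. Qed.

Fact L2scaleDr : right_distributive L2scale +%R.
Proof.
move=> a; elim/L2W => f; elim/L2W => g.
by rewrite -L2piD 3!L2pi_scale scalerDr L2piD.
Qed.

Fact L2scaleDl u : {morph L2scale^~ u : a b / a + b}.
Proof.
by move=> a b; elim/L2W: u => f; rewrite 3!L2pi_scale scalerDl L2piD.
Qed.

HB.instance Definition _ := GRing.Zmodule_isLmodule.Build C L2
  L2scaleA L2scale1 L2scaleDr L2scaleDl.

Lemma L2piZ a f : \pi_L2 (a *: f) = a *: \pi_L2 f.
Proof. by rewrite -L2pi_scale. Qed.

(* Inner products are linear in the first argument, following the library's
   {dot _ for _}. *)
Definition L2dot (u v : L2) : C :=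
  cintegral mu (fun x => repr u x * (repr v x)^*).

Lemma L2dot_pi (f g : L2fun) :
  L2dot (\pi_L2 f) (\pi_L2 g) = cintegral mu (fun x => f x * (g x)^*).
Proof.
have m (h : L2fun) : cmeasurable h by have [] := L2funP h.
apply: ae_eq_cintegral.
- by apply: cmeasurableM => //; exact: cmeasurableJ.
- by apply: cmeasurableM => //; exact: cmeasurableJ.
- by apply: filterS2 (L2_repr f) (L2_repr g) => x -> ->.
Qed.

Fact L2dot_linearl v : linear_for *%R (L2dot^~ v).
Proof.
move=> a; elim/L2W: v => v; elim/L2W => u; elim/L2W => w.
rewrite -L2piZ -L2piD 3!L2dot_pi.
rewrite -cintegralZ; last by apply: cintegrableMJ; exact: L2funP.
rewrite -cintegralD.
- by congr cintegral; apply/funext => x /=; rewrite !fctE mulrDl -mulrA.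
- have := cintegrableMJ (square_integrableZ a (L2funP u)) (L2funP v).
  rewrite /=; set F := (X in cintegrable _ X -> _); set G := (X in _ -> cintegrable _ X).
  suff -> : F = G by []. by apply/funext => x; rewrite /F /G /= !fctE -mulrA.
- by apply: cintegrableMJ; exact: L2funP.
Qed.

Fact L2dot_herm u v : L2dot u v = (-1) ^+ false * (L2dot v u)^*.
Proof.
rewrite expr0 mul1r /L2dot -cintegralJ; last first.
  by apply: cintegrableMJ; exact: L2funP.
by congr cintegral; apply/funext => x; rewrite rmorphM /= conjCK mulrC.
Qed.

Fact L2dot_linearr u : linear_for (Num.conj \; *%R) (L2dot u).
Proof.
move=> a v w; rewrite L2dot_herm L2dot_linearl.
rewrite [L2dot u v]L2dot_herm [L2dot u w]L2dot_herm !expr0 !mul1r.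
by rewrite rmorphD rmorphM.
Qed.

Fact L2dot_gt0 u : u != 0 -> 0 < L2dot u u.
Proof.
move=> u0; rewrite lt_def cintegral_sqr_ge0 ?andbT; last exact: L2funP.
apply: contra u0 => /eqP /cintegral_sqr_eq0 => /(_ (L2funP _)) u0.
apply/eqP; rewrite -[u]reprK -[RHS]reprK; apply/L2_eqP.
have := L2_repr 0; rewrite !piE.
by apply: filterS2 u0 => x -> ->.
Qed.

HB.instance Definition _ := @bilinear_isBilinear.Build C L2 L2 C
  *%R (Num.conj \; *%R) L2dot (L2dot_linearl, L2dot_linearr).
HB.instance Definition _ :=
  isHermitianSesquilinear.Build C L2 false Num.conj L2dot L2dot_herm.
HB.instance Definition _ := isDotProduct.Build C L2 L2dot L2dot_gt0.

End L2Space.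

Section FiniteDimensional.
Variables (R : realType) (V : vectType R[i]) (ip : {dot V for Num.conj}).
Implicit Types A B : 'End(V).

Definition hnorm (v : V) : R := Num.sqrt (Re (ip v v)).

Definition opnorm A : \bar R :=
  ereal_sup [set (hnorm (A v))%:E | v in [set v | hnorm v <= 1]].

(* Existence and uniqueness of the adjoint: adjointE and dot_inj. *)
Definition adjoint A : 'End(V) :=
  xget 0 [set B : 'End(V) | forall u v, ip (A u) v = ip u (B v)].

(* The class S_n, for an operator on the complex Hilbert space (V, ip). *)
Record in_S (n : nat) A : Prop := InS {
  S_dim : \dim {:V} = n;
  S_contraction : (opnorm A <= 1)%E;
  S_cnu : forall a : R[i], passmx.leigenvalue A a -> `|a| != 1;
  S_defect : \dim (limg (\1%VF - (adjoint A \o A)%VF)) = 1%N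
}.

Lemma dot_inj (u v : V) : (forall w, ip u w = ip v w) -> u = v.
Proof.
move=> uv; apply/eqP; rewrite -subr_eq0 -(dnorm_eq0 ip).
by rewrite linearBl subr_eq0; apply/eqP/uv.
Qed.

Lemma riesz (phi : V -> R[i]) : scalar phi -> exists w, forall v, phi v = ip v w.
Proof.
move=> phi_lin.
pose phiL : {scalar V} := HB.pack phi (GRing.isLinear.Build _ _ _ _ phi phi_lin).
pose e := vbasis {:V}; pose n := \dim {:V}.
pose f (w : V) : 'rV[R[i]]_n := \row_i ip w e`_i.
have f_lin : linear f.
  by move=> a u v; apply/rowP => i; rewrite !mxE linearPl.
pose fL : {linear V -> 'rV[R[i]]_n} :=
  HB.pack f (GRing.isLinear.Build _ _ _ _ f f_lin).
have expand v : v = \sum_(i < n) coord e i v *: e`_i.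
  by rewrite {1}(coord_vbasis (memvf v)).
have ker0 : lker (linfun fL) == 0%VS.
  apply/lker0P => u v; rewrite !lfunE /= => uv; apply: dot_inj => w.
  rewrite (expand w) !linear_sumr; apply: eq_bigr => i _.
  rewrite !linearZr_LR /=; congr (_ * _).
  by have /rowP /(_ i) := uv; rewrite !mxE.
have full : limg (linfun fL) = fullv.
  apply/eqP; rewrite eqEdim subvf /= limg_dim_eq; last first.
    by move/eqP: ker0 => ->; rewrite capv0.
  by rewrite [X in (X <= _)%N]dimvf /dim /= mul1n.
have /memv_imgP[w _ we] : (\row_i (phi e`_i)^*) \in limg (linfun fL).
  by rewrite full memvf.
exists w => v; rewrite (expand v) -[phi]/(phiL : V -> _) linear_sum linear_sumlz.
apply: eq_bigr => i _; rewrite linearZ /= linearZl_LR /=; congr (_ * _).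
move: we; rewrite lfunE => /rowP/(_ i); rewrite !mxE => /(congr1 Num.conj).
by rewrite conjCK => ->; rewrite [RHS]hermC expr0 mul1r.
Qed.

Lemma adjointE A u v : ip (A u) v = ip u (adjoint A v).
Proof.
suff [B BE] : exists B : 'End(V), forall u v, ip (A u) v = ip u (B v).
  rewrite /adjoint; case: xgetP => [C _ /= -> //|/(_ B)]; exact.
have lin v0 : scalar (fun u0 => ip (A u0) v0).
  by move=> a x y; rewrite linearP linearPl.
have /choice[b bE] v0 : exists w, forall u0, ip (A u0) v0 = ip u0 w.
  exact: riesz (lin v0).
have ipI x y : (forall w, ip w x = ip w y) -> x = y.
  move=> xy; apply: dot_inj => w.
  by rewrite hermC [RHS]hermC; congr (_ * _^*); exact: xy.
have b_lin : linear b.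
  move=> a x y; apply: ipI => w.
  apply: etrans (esym (bE _ _)) _; rewrite !linearPr /=.
  by congr (_ * _ + _); exact: bE.
pose bL : {linear V -> V} := HB.pack b (GRing.isLinear.Build _ _ _ _ b b_lin).
by exists (linfun bL) => u0 v0; rewrite lfunE; exact: bE.
Qed.

End FiniteDimensional.

Section OrthogonalProjection.
Variables (R : realType) (H : lmodType R[i]) (ip : {dot H for Num.conj}).

(* The orthogonal projection onto W; it exists and is unique when W is
   finite-dimensional (orthoproj_range, orthoproj_unique). *)
Definition orthoproj (W : set H) (h : H) : H :=
  xget 0 [set w | W w /\ forall v, W v -> ip (h - w) v = 0].

Variables (V : vectType R[i]) (emb : {linear V -> H}).
Let W := range emb.

Lemma orthoproj_range (dotV : {dot V for Num.conj}) h :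
    (forall u v, dotV u v = ip (emb u) (emb v)) ->
  W (orthoproj W h) /\ forall v, W v -> ip (h - orthoproj W h) v = 0.
Proof.
move=> dotVE; rewrite /orthoproj.
suff [w ww] : exists w, W w /\ forall v, W v -> ip (h - w) v = 0.
  by case: xgetP => [x -> //|/(_ w)].
have [|w wE] := @riesz _ _ dotV (fun v => ip (emb v) h).
  by move=> a x y; rewrite linearP linearPl.
exists (emb w); split; first by exists w.
move=> _ [v _ <-].
have vh : ip (emb v) (h - emb w) = 0.
  rewrite linearBr; apply/eqP; rewrite subr_eq0; apply/eqP.
  exact: etrans (wE v) (dotVE _ _).
by rewrite hermC expr0 mul1r; exact: etrans (congr1 Num.conj vh) (conjC0 _).
Qed.

Lemma orthoproj_unique h w w' : W w -> W w' ->
    (forall v, W v -> ip (h - w) v = 0) ->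
    (forall v, W v -> ip (h - w') v = 0) -> w = w'.
Proof.
move=> [v _ <-] [v' _ <-] wE w'E; apply/eqP; rewrite -subr_eq0.
apply: contraT => /(neq0_dnorm_gt0 (s := ip)).
have Wd : W (emb v - emb v') by exists (v - v') => //; rewrite linearB.
have dE : emb v - emb v' = (h - emb v') - (h - emb v).
  by rewrite opprB [RHS]addrC addrA subrK.
suff -> : ip (emb v - emb v') (emb v - emb v') = 0 by rewrite ltxx.
rewrite {1}dE linearBl; apply/eqP; rewrite subr_eq0; apply/eqP.
exact: etrans (w'E _ Wd) (esym (wE _ Wd)).
Qed.

End OrthogonalProjection.

Section Circle.
Variable R : realType.

(* The unit circle, with the subspace topology inherited from R[i]^o. *)
Definition circle : Type := set_type ([set z | `|z| = 1] : set R[i]^o).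

HB.instance Definition _ := Topological.copy circle
  (set_type ([set z | `|z| = 1] : set R[i]^o)).

Fact circle1_subproof : (1 : R[i]) \in ([set z | `|z| = 1] : set R[i]^o).
Proof. by rewrite inE /= normr1. Qed.

HB.instance Definition _ :=
  isPointed.Build circle (exist _ (1 : R[i]) circle1_subproof).

Definition borel_circle : Type := g_sigma_algebraType (@open circle).
HB.instance Definition _ := Measurable.on borel_circle.

Definition circle_val (z : borel_circle) : R[i] := set_val z.


Lemma circle_normc z : Normc.normc (circle_val z) = 1.
Proof.
have := valP z; rewrite inE /= => z1.
by apply: complexI; rewrite -[RHS]z1.
Qed.

Lemma circle_val_measurable : cmeasurable circle_val.
Proof.
have I (h : R[i] -> R) : (forall x y, h x - h y <= Normc.normc (x - y)) ->
    measurable_fun setT (h \o circle_val).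
  move=> hl; apply: (measurability _ (RGenOInfty.measurableE R)) => //.
  move=> _ [_ [a ->] <-]; rewrite setTI; apply: sub_sigma_algebra.
  exists [set c : R[i]^o | a < h c]; last first.
    by apply/seteqP; split => z /=; rewrite in_itv/= andbT.
  rewrite openE => c /= ac; apply/nbhs_ballP.
  exists (h c - a)%:C%C; first by rewrite /= ltcR subr_gt0.
  move=> y; rewrite -ball_normE /= => cy.
  have : h c - h y < h c - a.
    by apply: le_lt_trans (hl c y) _; rewrite -ltcR.
  by rewrite ltrD2l ltrN2.
split; apply: I => x y.
  apply: le_trans (ler_norm _) _; rewrite -lecR.
  by have := normc_ge_Re (x - y); rewrite raddfB.
apply: le_trans (ler_norm _) _; rewrite -sqrtr_sqr; case: x y => [a b] [a' b'].
by rewrite /= ler_wsqrtr// lerDr sqr_ge0.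
Qed.

End Circle.

Section CompressedMultiplication.
Variables (R : realType) (mu : probability (borel_circle R) R) (n : nat).
Local Notation C := R[i].
Local Notation circle := (borel_circle R).
Local Open Scope quotient_scope.

Fact square_integrable_mulz (f : circle -> C) : square_integrable mu f ->
  square_integrable mu (fun z => circle_val z * f z).
Proof.
move=> sf; apply: (@square_integrable_bounded _ _ _ _ _ 1) => //.
  exact: circle_val_measurable.
by move=> z; rewrite circle_normc.
Qed.

Fact square_integrable_poly (p : {poly C}) :
  square_integrable mu (fun z => p.[circle_val z]).
Proof.
elim/poly_ind: p => [|p c IHp].
  have -> : (fun z : circle => (0 : {poly C}).[circle_val z]) = 0.
    by apply/funext => z; rewrite horner0.
  exact: square_integrable0.
have -> : (fun z : circle => (p * 'X + c%:P).[circle_val z]) =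
    (fun z => circle_val z * p.[circle_val z]) + (fun=> c).
  by apply/funext => z; rewrite /= !fctE hornerMXaddC mulrC.
apply: square_integrableD; first exact: square_integrable_mulz.
split; first exact: cmeasurable_cst.
rewrite integral_cst//= (_ : mu setT = 1%E) ?mule1 ?ltry//.
exact: probability_setT.
Qed.

Definition poly_fun (p : {poly_n C}) : L2fun mu :=
  MkL2fun (asboolT (square_integrable_poly p)).

(* {poly_n R[i]} is the space of polynomials of degree at most n - 1; poly_L2
   is its inclusion in L^2, injective when mu is non-trivial (poly_L2_inj). *)
Definition poly_L2 (p : {poly_n C}) : L2 mu := \pi_(L2 mu) (poly_fun p).

Definition mulz_fun (f : L2fun mu) : L2fun mu :=
  MkL2fun (asboolT (square_integrable_mulz (L2funP f))).

Definition mulz (u : L2 mu) : L2 mu := \pi_(L2 mu) (mulz_fun (repr u)).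

Fact poly_L2_linear : linear poly_L2.
Proof.
move=> a p q; rewrite -L2piZ -L2piD; congr (\pi_(L2 mu) _); apply/val_inj.
by apply/funext => z; rewrite /= !fctE hornerD hornerZ.
Qed.
HB.instance Definition _ :=
  GRing.isLinear.Build C {poly_n C} (L2 mu) _ poly_L2 poly_L2_linear.

Lemma mulz_pi f : mulz (\pi_(L2 mu) f) = \pi_(L2 mu) (mulz_fun f).
Proof. by apply/L2_eqP; apply: filterS (L2_repr f) => z /= ->. Qed.

Fact mulz_linear : linear mulz.
Proof.
move=> a; elim/L2W => f; elim/L2W => g.
rewrite -L2piZ -L2piD 3!mulz_pi -L2piZ -L2piD.
congr (\pi_(L2 mu) _); apply/val_inj/funext => z /=.
by rewrite !fctE mulrDr mulrCA.
Qed.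
HB.instance Definition _ := GRing.isLinear.Build C (L2 mu) (L2 mu) _ mulz mulz_linear.

Definition poly_proj : L2 mu -> L2 mu :=
  orthoproj (@L2dot _ _ R mu) (range poly_L2).

(* Inverse of poly_L2 on its range. *)
Definition L2_poly (u : L2 mu) : {poly_n C} :=
  xget 0 [set p | poly_L2 p = u].

(* P_n M_z P_n restricted to the polynomials; linfun yields the operator with
   these values because they depend linearly on p (compressed_mulE). *)
Definition compressed_mul : 'End({poly_n C}) :=
  linfun (fun p => L2_poly (poly_proj (mulz (poly_proj (poly_L2 p))))).

Definition nontrivial :=
  ~ exists F : set circle, finite_set F /\ mu (~` F) = 0%E.

Hypothesis mu_nt : nontrivial.

Lemma poly_L2_inj : injective poly_L2.
Proof.
apply: raddf_inj => p; rewrite -(raddf0 poly_L2) => /L2_eqP p0.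
apply: contra_notP mu_nt => /eqP pn0.
have {}pn0 : polyn p != 0 by apply: contra pn0 => /eqP p0'; exact/eqP/val_inj.
exists [set z | p.[circle_val z] = 0]; split.
  have [s sE] := closed_field_poly_normal (polyn p).
  have sub : [set z | p.[circle_val z] = 0] `<=` @circle_val R @^-1` [set` s].
    move=> z /= /eqP; rewrite sE hornerZ mulf_eq0 lead_coef_eq0 (negPf pn0) /=.
    by rewrite -/(root _ _) root_prod_XsubC.
  apply: sub_finite_set sub _.
  apply: finite_preimage; last exact: finite_seq.
  by move=> x y _ _; exact: val_inj.
apply/negligibleP; last first.
  by apply: filterS p0 => z /=; rewrite horner0.
apply: measurableC.
have [[mr mj] _] := square_integrable_poly p.
rewrite [X in measurable X](_ : _ =
    ((Re \o (fun z => p.[circle_val z])) @^-1` [set 0]) `&`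
    ((Im \o (fun z => p.[circle_val z])) @^-1` [set 0])).
  apply: measurableI.
    by rewrite -[X in measurable X]setTI; exact: mr.
  by rewrite -[X in measurable X]setTI; exact: mj.
apply/seteqP; split => z /=; first by move=> ->.
by move=> [r0 j0]; exact: complex_ext.
Qed.

(* Inner product inherited from L^2; it is positive definite because mu is
   non-trivial, hence the dependency on the proof. *)
Definition poly_dot of nontrivial := fun p q : {poly_n C} =>
  L2dot (poly_L2 p) (poly_L2 q).
Local Notation dot := (poly_dot mu_nt).

Fact poly_dot_bilinear : bilinear_for *%R (Num.conj \; *%R) dot.
Proof.
split=> [q a p p'|p a q q']; rewrite /poly_dot linearP.
  by rewrite linearPl.
by rewrite linearPr.
Qed.

Fact poly_dot_herm p q : dot p q = (-1) ^+ false * (dot q p)^*.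
Proof. exact: L2dot_herm. Qed.

Fact poly_dot_gt0 p : p != 0 -> 0 < dot p p.
Proof. by move=> p0; apply: L2dot_gt0; rewrite raddf_eq0//; exact: poly_L2_inj. Qed.

HB.instance Definition _ := @bilinear_isBilinear.Build C {poly_n C} {poly_n C} C
  *%R (Num.conj \; *%R) dot poly_dot_bilinear.
HB.instance Definition _ := isHermitianSesquilinear.Build
  C {poly_n C} false Num.conj dot poly_dot_herm.
HB.instance Definition _ := isDotProduct.Build C {poly_n C} dot poly_dot_gt0.

Lemma poly_projP u : range poly_L2 (poly_proj u) /\
  forall v, range poly_L2 v -> L2dot (u - poly_proj u) v = 0.
Proof. exact: (@orthoproj_range _ _ (@L2dot _ _ R mu) _ poly_L2 dot). Qed.

Lemma poly_proj_unique u v : range poly_L2 v ->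
  (forall w, range poly_L2 w -> L2dot (u - v) w = 0) -> poly_proj u = v.
Proof.
move=> Wv vE; have [Wp pE] := poly_projP u.
exact: (@orthoproj_unique _ _ (@L2dot _ _ R mu) _ poly_L2 u).
Qed.

Lemma poly_proj_poly p : poly_proj (poly_L2 p) = poly_L2 p.
Proof.
apply: poly_proj_unique => [|w _]; first by exists p.
by rewrite subrr linear0l.
Qed.

Fact poly_proj_linear : linear poly_proj.
Proof.
move=> a u v; have [[p _ pu] uE] := poly_projP u.
have [[q _ qv] vE] := poly_projP v.
apply: poly_proj_unique => [|w Ww].
  by exists (a *: p + q) => //; rewrite linearP /= pu qv.
have -> : a *: u + v - (a *: poly_proj u + poly_proj v) =
    a *: (u - poly_proj u) + (v - poly_proj v).
  by rewrite opprD addrACA scalerBr.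
apply: etrans (L2dot_linearl w a _ _) _.
by rewrite (uE _ Ww) (vE _ Ww) mulr0 addr0.
Qed.

Lemma compressed_mulE p :
  poly_L2 (compressed_mul p) = poly_proj (mulz (poly_L2 p)).
Proof.
rewrite /compressed_mul.
set f := fun p => _.
have fE q : poly_L2 (f q) = poly_proj (mulz (poly_L2 q)).
  rewrite /f poly_proj_poly /L2_poly; case: xgetP => [r -> //|].
  have [[r _ rE] _] := poly_projP (mulz (poly_L2 q)).
  by move=> /(_ r).
move: f fE => f fE.
have f_lin : linear f.
  move=> a q r; apply: poly_L2_inj; apply: etrans (fE _) _.
  apply: etrans (esym (poly_L2_linear a _ _)).
  by rewrite 2!fE poly_L2_linear mulz_linear poly_proj_linear.
pose fL : {linear {poly_n C} -> {poly_n C}} :=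
  HB.pack f (GRing.isLinear.Build _ _ _ _ f f_lin).
by rewrite -fE -[f]/(fL : _ -> _) lfunE.
Qed.

End CompressedMultiplication.

Arguments poly_dot {R mu} n mu_nt p q : rename.

(* Main.v *)
(* Multiplication by z is unitary on L^2 of the circle, so
   |A p|^2 = |p|^2 - |z p - P (z p)|^2.  Hence A is a contraction, and
   |A p| = |p| exactly when z p lies in the span of the polynomials of degree
   less than n; as mu is non-trivial, this forces A p = X p as polynomials,
   i.e. deg p < n - 1.  An eigenvector for a unimodular eigenvalue would satisfy
   X p = a p, which is impossible by degrees.  Likewise 1 - A^* A vanishes on
   the polynomials of degree less than n - 1 but not at X^(n-1), so its range is
   the line spanned by the image of X^(n-1). *)
Require Import Defs.
From HB Require Import structures.
From mathcomp Require Import all_boot all_order all_algebra.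
From mathcomp Require Import all_classical all_reals all_analysis.
From mathcomp Require Import complex.
Import Order.TTheory GRing.Theory Num.Theory.
Set Implicit Arguments.
Unset Strict Implicit.
Unset Printing Implicit Defensive.
Local Open Scope ring_scope.
Local Open Scope quotient_scope.

Section Defect.
Context (R : realType) (V : vectType R[i]) (ip : {dot V for Num.conj}).
Variable A : 'End(V).

(** Conjugate symmetry moves [adjoint] into the second slot, where [adjointE] removes it; the defect
    operator can then be studied through inner products alone. *)
Lemma dot_defect u v :
  ip ((\1%VF - (adjoint ip A \o A)%VF) u) v = ip u v - ip (A u) (A v).
Proof.
rewrite add_lfunE opp_lfunE id_lfunE comp_lfunE linearBl /=; congr (_ - _).
have e : ip (A v) (A u) = ip v (adjoint ip A (A u)) by exact: adjointE.
by rewrite [LHS]hermC [RHS]hermC /= e.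
Qed.

(** Modulo [e], every vector lies in the kernel of the defect operator, while [e] itself does
    not. *)
Lemma dim_defect1 (e : V) : ip (A e) (A e) != ip e e ->
    (forall u, exists c, forall v,
      ip (A (u - c *: e)) (A v) = ip (u - c *: e) v) ->
  \dim (limg (\1%VF - (adjoint ip A \o A)%VF)) = 1%N.
Proof.
set B := _ - _ => Ae eP; suff -> : limg B = <[B e]>%VS.
  rewrite dim_vline; case: eqP => // Be; move: Ae; rewrite eq_sym -subr_eq0.
  by rewrite -dot_defect -/B Be linear0l eqxx.
apply/eqP; rewrite eqEsubv; apply/andP; split; last first.
  by rewrite -memvE memv_img ?memvf.
apply/subvP => _ /memv_imgP[u _ ->]; have [c cP] := eP u.
apply/vlineP; exists c; apply/eqP.
rewrite -linearZ -subr_eq0 -linearB; apply/eqP.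
by apply: (dot_inj (ip := ip)) => v; rewrite linear0l dot_defect cP subrr.
Qed.

End Defect.

Section CircleMultiplication.
Context (R : realType) (mu : probability (borel_circle R) R).

Lemma circle_valMJ (z : borel_circle R) :
  circle_val z * (circle_val z)^* = 1.
Proof.
have z1 : `|circle_val z| = 1 by have := valP z; rewrite inE.
by rewrite -normCK z1 expr1n.
Qed.

Lemma L2dot_mulz (u v : L2 mu) : L2dot (mulz u) (mulz v) = L2dot u v.
Proof.
elim/L2W: u => f; elim/L2W: v => g; rewrite 2!mulz_pi 2!L2dot_pi.
congr cintegral; apply/funext => z /=.
by rewrite rmorphM mulrACA circle_valMJ mul1r.
Qed.

Lemma mulz_poly m n (p : {poly_m R[i]}) (q : {poly_n R[i]}) :
  q = 'X * p :> {poly R[i]} -> mulz (poly_L2 mu p) = poly_L2 mu q.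
Proof.
move=> qE; rewrite mulz_pi; congr (\pi_(L2 mu) _); apply/val_inj/funext => z /=.
by rewrite qE hornerM hornerX.
Qed.

Lemma poly_L2_val m n (p : {poly_m R[i]}) (q : {poly_n R[i]}) :
  p = q :> {poly R[i]} -> poly_L2 mu p = poly_L2 mu q.
Proof.
move=> pq; congr (\pi_(L2 mu) _); apply/val_inj/funext => z /=.
by rewrite pq.
Qed.

Hypothesis mu_nt : nontrivial mu.

(** Both polynomials are viewed under the larger size bound, where [poly_L2_inj] applies. *)
Lemma poly_L2_inj_val m n (p : {poly_m R[i]}) (q : {poly_n R[i]}) :
  poly_L2 mu p = poly_L2 mu q -> p = q :> {poly R[i]}.
Proof.
have wide k (r : {poly_k R[i]}) : (k <= maxn m n)%N ->
    npolyp (maxn m n) r = r :> {poly R[i]}.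
  by move=> km; rewrite npolypK// (leq_trans (size_npoly r)).
have pE := wide _ p (leq_maxl m n); have qE := wide _ q (leq_maxr m n).
rewrite -(poly_L2_val pE) -(poly_L2_val qE) => /(poly_L2_inj mu_nt) e.
by rewrite -pE -qE e.
Qed.

Section Compression.
Variable n : nat.
Local Notation A := (compressed_mul mu n).
Local Notation dot := (poly_dot n mu_nt).
Implicit Types p q : {poly_n R[i]}.

Let D p := mulz (poly_L2 mu p) - poly_L2 mu (A p).

Lemma L2dot_defect p q : L2dot (D p) (poly_L2 mu q) = 0.
Proof.
rewrite /D (compressed_mulE mu_nt).
by have [_] := poly_projP n mu_nt (mulz (poly_L2 mu p)); apply; exists q.
Qed.

(** Pythagoras for the orthogonal splitting of [z p], whose norm is that of [p]. *)
Lemma dot_compressed_mul p : dot p p = dot (A p) (A p) + L2dot (D p) (D p).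
Proof.
have zE : mulz (poly_L2 mu p) = D p + poly_L2 mu (A p) by rewrite subrK.
rewrite {1}/poly_dot -L2dot_mulz zE.
have := hnormDd (form := @L2dot _ _ R mu) (L2dot_defect p (A p)).
by rewrite [RHS]addrC.
Qed.

Lemma compressed_mul_contraction p : dot (A p) (A p) <= dot p p.
Proof.
by rewrite [leRHS]dot_compressed_mul lerDl cintegral_sqr_ge0//; exact: L2funP.
Qed.

Lemma compressed_mul_isometric p :
  dot (A p) (A p) = dot p p -> A p = 'X * polyn p :> {poly R[i]}.
Proof.
rewrite [RHS]dot_compressed_mul addrC => /eqP.
rewrite -subr_eq subrr eq_sym => D0.
have /eqP : D p = 0 by apply/eqP; rewrite -(dnorm_eq0 (@L2dot _ _ R mu)).
rewrite subr_eq0 => /eqP zE.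
(* Multiplying by ['X] can raise the size to [n.+1], so the comparison takes place in the next
   larger space. *)
have Xp : npolyp n.+1 ('X * p) = 'X * polyn p :> {poly R[i]}.
  by rewrite npolypK// (leq_trans (size_polyMleq _ _))// size_polyX ltnS.
by rewrite -Xp; apply: poly_L2_inj_val; rewrite -(mulz_poly Xp).
Qed.

Lemma compressed_mul_small p :
  (size p < n)%N -> poly_L2 mu (A p) = mulz (poly_L2 mu p).
Proof.
move=> pn; have Xp : npolyp n ('X * p) = 'X * polyn p :> {poly R[i]}.
  by rewrite npolypK// (leq_trans (size_polyMleq _ _))// size_polyX.
by rewrite (compressed_mulE mu_nt) (mulz_poly Xp) (poly_proj_poly mu_nt).
Qed.

Lemma compressed_mul_cnu (a : R[i]) :
  passmx.leigenvalue A a -> `|a| != 1.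
Proof.
rewrite /passmx.leigenvalue -vpick0; set p := vpick _ => p0.
have : p \in passmx.leigenspace A a by exact: memv_pick.
rewrite memv_ker add_lfunE opp_lfunE scale_lfunE id_lfunE subr_eq0 => /eqP Ap.
apply/eqP => a1.
have : A p = 'X * polyn p :> {poly R[i]}.
  apply: compressed_mul_isometric; rewrite Ap.
  by apply: etrans (dnormZ dot a p) _; rewrite a1 expr1n mul1r.
have {}p0 : polyn p != 0 by apply: contra p0 => /eqP e; apply/eqP/val_inj.
(* As [a] is nonzero, scaling by [a] keeps the size of [p], whereas ['X] raises it by one. *)
rewrite Ap linearZ /= => /(congr1 (fun q : {poly R[i]} => size q)).
rewrite size_scale; last first.
  apply/eqP => a0; move: a1; rewrite a0 normr0 => /eqP.
  by rewrite eq_sym oner_eq0.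
by rewrite [_ * _]mulrC size_mulX// => /n_Sn.
Qed.

(** Here [A p] is exactly [z p], and [z q] differs from [A q] by [D q], which is orthogonal to
    [A p]; so [q] needs no size bound. *)
Lemma dot_compressed_mul_small p q :
  (size p < n)%N -> dot (A p) (A q) = dot p q.
Proof.
move=> pn; rewrite [RHS]/poly_dot -L2dot_mulz -compressed_mul_small//.
apply/esym/eqP; rewrite -[poly_dot _ _ _ _]/(L2dot _ _) -subr_eq0 -linearBr.
apply/eqP; apply: etrans (L2dot_herm _ _) _; rewrite expr0 mul1r.
exact: etrans (congr1 Num.conj (L2dot_defect q (A p))) (conjC0 _).
Qed.

End Compression.
End CircleMultiplication.

Theorem theorem1 (R : realType) (n : nat) (mu : probability (borel_circle R) R)
    (mu_nt : nontrivial mu) (n_ge1 : (1 <= n)%N) :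
  in_S (poly_dot n mu_nt) n (compressed_mul mu n).
Proof.
split.
- exact: dim_polyn.
- apply: ge_ereal_sup => _ [v /= v1 <-]; rewrite lee_fin.
  apply: le_trans v1; apply: ler_wsqrtr.
  by have := compressed_mul_contraction mu_nt v; rewrite lecE => /andP[].
- exact: compressed_mul_cnu.
- pose e : {poly_n R[i]} := npolyp n 'X^(n.-1).
  have eE : e = 'X^(n.-1) :> {poly R[i]}.
    by rewrite npolypK// size_polyXn prednK.
  apply: (dim_defect1 (e := e)) => [|p].
    (* Equality would make [A e] the monomial ['X^n], of size [n.+1], too large for the space. *)
    apply/eqP => /compressed_mul_isometric.
    rewrite eE -exprS prednK// => /(congr1 (fun q : {poly R[i]} => size q)) Ae.
    by have := size_npoly (compressed_mul mu n e); rewrite Ae size_polyXn ltnn.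
  (* Subtracting the coefficient of degree [n.-1] times [e] leaves size at most [n.-1]. *)
  exists p`_n.-1 => q; apply: dot_compressed_mul_small.
  rewrite -[X in (_ < X)%N](prednK n_ge1) ltnS; apply/leq_sizeP => i.
  rewrite -[polyn _]/(polyn p - p`_n.-1 *: polyn e).
  rewrite coefB coefZ eE coefXn leq_eqVlt => /predU1P[<-|ni].
    by rewrite eqxx mulr1 subrr.
  by rewrite gtn_eqF// mulr0 subr0 big_coef_npoly// -(prednK n_ge1).
Qed.
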